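(* Let $F\colon\mathbf{Set}\to\mathbf{Set}$ be a weak pullback preserving functor with a well-behaved evaluation function $ev_F$, and let $(X,d)$ be a metric space. Suppose that for all $t_1,t_2\in FX$ with $W^F_d(t_1,t_2)=0$ there is a coupling $\gamma(t_1,t_2)$ of $t_1,t_2$ with $\tilde Fd(\gamma(t_1,t_2))=0$. Then $W^F_d$ is a metric on $FX$.
   Context: Fix $\top\in(0,\infty]$; a pseudometric on $X$ is $d\colon X\times X\to[0,\top]$ that is reflexive, symmetric and satisfies the triangle inequality; a metric additionally satisfies $d(x,y)=0\Rightarrow x=y$. $d_e$ is the Euclidean distance on $[0,\top]$ (with $d_e(a,\infty)=\infty$ for $a\ne\infty$, $d_e(\infty,\infty)=0$). An evaluation function for $F$ is $ev_F\colon F[0,\top]\to[0,\top]$; $\tilde Fg=ev_F\circ Fg$ for $g\colon X\to[0,\top]$. $ev_F$ is well-behaved if (W1) $f\le g$ implies $\tilde Ff\le\tilde Fg$; (W2) for every $t\in F([0,\top]^2)$, $d_e(ev_F(F\pi_1 t),ev_F(F\pi_2 t))\le\tilde Fd_e(t)$; (W3) $ev_F^{-1}[\{0\}]=Fi[F\{0\}]$, $i\colon\{0\}\hookrightarrow[0,\top]$. A coupling of $t_1,t_2\in FX$ is $t\in F(X\times X)$ with $F\pi_i(t)=t_i$; $W^F_d(t_1,t_2)=\inf\{\tilde Fd(t)\mid t\text{ coupling of }t_1,t_2\}$ ($\inf\emptyset=\top$). *)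

(* Defs.v *)
From HB Require Import structures.
From mathcomp Require Import all_boot all_order all_algebra.
From mathcomp Require Import boolp classical_sets reals constructive_ereal ereal.

Set Implicit Arguments.
Unset Strict Implicit.
Unset Printing Implicit Defensive.

Import Order.TTheory GRing.Theory Num.Theory.
Local Open Scope classical_set_scope.
Local Open Scope ring_scope.
Local Open Scope ereal_scope.

(** A single fixed universe, so that a functor below maps [Sets] to itself. *)
Definition Sets := Type.

Record functor := Functor {
  fobj :> Sets -> Sets;
  fmap : forall A B : Sets, (A -> B) -> fobj A -> fobj B;
  fmap_id : forall A : Sets, fmap (@id A) = id;
  fmap_comp : forall (A B C : Sets) (g : B -> C) (f : A -> B),
    fmap (g \o f) = fmap g \o fmap f }.

Arguments fmap F {A B} f _ : rename.

Record weak_pullback (P A B C : Sets)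
    (p : P -> A) (q : P -> B) (f : A -> C) (g : B -> C) : Prop := WeakPullback {
  wpb_comm : f \o p = g \o q;
  wpb_mediating : forall (Z : Sets) (h : Z -> A) (k : Z -> B),
    f \o h = g \o k -> exists m : Z -> P, p \o m = h /\ q \o m = k }.

Definition preserves_weak_pullbacks (F : functor) : Prop :=
  forall (P A B C : Sets) (p : P -> A) (q : P -> B) (f : A -> C) (g : B -> C),
    weak_pullback p q f g ->
    weak_pullback (fmap F p) (fmap F q) (fmap F f) (fmap F g).

(** The interval [[0, top]], where [top] may be [+oo]. *)
Definition dval (R : realType) (top : \bar R) : Sets :=
  {x : \bar R | 0 <= x <= top}.

Section Metric.
Variables (R : realType) (top : \bar R) (X : Sets) (d : X * X -> dval top).

Record is_pseudometric : Prop := IsPseudometric {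
  pseudometric_refl : forall x, val (d (x, x)) = 0;
  pseudometric_sym : forall x y, d (x, y) = d (y, x);
  pseudometric_triangle : forall x y z,
    val (d (x, z)) <= val (d (x, y)) + val (d (y, z)) }.

Record is_metric : Prop := IsMetric {
  metric_pseudometric : is_pseudometric;
  metric_eq : forall x y, val (d (x, y)) = 0 -> x = y }.

End Metric.

Section Euclidean.
Variables (R : realType) (top : \bar R).

(** The case distinction is needed because [`|+oo - +oo| = +oo] in the library,
    whereas the distance from [+oo] to itself is [0]. *)
Definition euclid_val (p : dval top * dval top) : \bar R :=
  if val p.1 == val p.2 then 0 else `|val p.1 - val p.2|.

Lemma euclid_val_bounds p : 0 <= euclid_val p <= top.
Proof.
rewrite /euclid_val; case: p => -[a /= /andP[a0 at_]] [b /= /andP[b0 bt]].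
case: eqP => [_|_]; first by rewrite lexx (le_trans a0 at_).
rewrite abse_ge0 /=.
have [->|topN] := eqVneq top +oo; first exact: leey.
case: top topN at_ bt => [t| |] // _; case: a a0 => [a| |] // a0 at_.
case: b b0 => [b| |] // b0 bt; move: a0 at_ b0 bt; rewrite !lee_fin.
move=> a0 at_ b0 bt; rewrite ler_norml lerNl opprB !lerBlDr.
by rewrite (le_trans bt) ?(le_trans at_) ?lerDl.
Qed.

Definition euclid (p : dval top * dval top) : dval top :=
  exist _ (euclid_val p) (euclid_val_bounds p).

End Euclidean.

Section Infimum.
Variables (R : realType) (top : \bar R) (top_gt0 : 0 < top).

(** Adjoining [top], an upper bound of [A], only matters when [A] is empty:
    the infimum of the empty set is [top], rather than [+oo]. *)
Definition dinf_val (A : set (dval top)) : \bar R :=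
  ereal_inf (top |` [set val a | a in A]).

Lemma dinf_val_bounds (A : set (dval top)) : 0 <= dinf_val A <= top.
Proof.
apply/andP; split; last by apply: ereal_inf_lbound; left.
apply: le_ereal_inf_tmp => _ [->|[a _ <-]]; first exact: ltW.
by case/andP: (valP a).
Qed.

Definition dinf (A : set (dval top)) : dval top :=
  exist _ (dinf_val A) (dinf_val_bounds A).

Lemma dinf_set0 : val (dinf set0) = top.
Proof. by rewrite /= /dinf_val image_set0 setU0 ereal_inf1. Qed.

Lemma dinf_lbound (A : set (dval top)) a : A a -> val (dinf A) <= val a.
Proof. by move=> Aa; apply: ereal_inf_lbound; right; exists a. Qed.

Lemma dinf_greatest (A : set (dval top)) (b : dval top) :
  (forall a, A a -> val b <= val a) -> val b <= val (dinf A).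
Proof.
move=> bA; apply: le_ereal_inf_tmp => _ [->|[a Aa <-]]; last exact: bA.
by case/andP: (valP b).
Qed.

End Infimum.

Section Evaluation.
Variables (R : realType) (top : \bar R) (F : functor).
Variable ev : F (dval top) -> dval top.

Definition evlift (X : Sets) (g : X -> dval top) : F X -> dval top :=
  ev \o fmap F g.

Definition dzero : set (dval top) := [set x | val x = 0].

Record well_behaved : Prop := WellBehaved {
  wb_monotone : forall (X : Sets) (f g : X -> dval top),
    (forall x, val (f x) <= val (g x)) ->
    forall t, val (evlift f t) <= val (evlift g t);
  wb_euclid : forall t : F (dval top * dval top)%type,
    val (euclid (ev (fmap F fst t), ev (fmap F snd t)))
      <= val (evlift (@euclid R top) t);
  wb_zero :
    ev @^-1` dzero = range (fmap F (val : set_type dzero -> dval top)) }.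

Definition coupling (X : Sets) (t1 t2 : F X) : set (F (X * X)%type) :=
  [set t | fmap F fst t = t1 /\ fmap F snd t = t2].

Definition wasserstein (top_gt0 : 0 < top) (X : Sets) (d : X * X -> dval top)
    (p : F X * F X) : dval top :=
  dinf top_gt0 [set evlift d t | t in coupling p.1 p.2].

End Evaluation.

(* Main.v *)
(** Each metric axiom comes from a map into a power of [X]. Reflexivity uses
    [F] of the diagonal and symmetry [F] of the swap. For the triangle
    inequality, weak pullback preservation glues couplings of [t1, t2] and of
    [t2, t3] to an element of [F (X^3)], and (W2) is applied to the pair of
    functions [d13], [d23] on [X^3], whose Euclidean distance is at most [d12].
    For separation, [d] being a metric says that the diagonal is the pullback
    of [{0}] along [d]; preserving this pullback, together with (W3), puts every
    coupling of cost [0] in the image of the diagonal. *)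

Require Import Defs.
From mathcomp Require Import all_boot all_order all_algebra.
From mathcomp Require Import boolp classical_sets reals constructive_ereal ereal.

Set Implicit Arguments.
Unset Strict Implicit.
Unset Printing Implicit Defensive.

Import Order.TTheory GRing.Theory Num.Theory.
Local Open Scope classical_set_scope.
Local Open Scope ring_scope.
Local Open Scope ereal_scope.

(* [filter.fmap] shadows the action of functors on maps. *)
Local Notation fmap := Defs.fmap.

(** Mediation for maps out of the one-point set. Elements of [F P] are obtained from preserved weak
    pullbacks in this form. *)
Lemma weak_pullback_point (P A B C : Sets) (p : P -> A) (q : P -> B)
    (f : A -> C) (g : B -> C) (a : A) (b : B) :
  weak_pullback p q f g -> f a = g b -> exists x, p x = a /\ q x = b.
Proof.
case=> _ med fgab.
have [|m [pm qm]] := med unit (fun=> a) (fun=> b).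
  by apply: funext => -[] /=.
by exists (m tt); split; [rewrite -[LHS]/((p \o m) tt) pm
                         |rewrite -[LHS]/((q \o m) tt) qm].
Qed.

Lemma fmap_compE (F : functor) (A B C : Sets) (g : B -> C) (f : A -> B) t :
  fmap F g (fmap F f t) = fmap F (g \o f) t.
Proof. by rewrite Defs.fmap_comp. Qed.

Lemma weak_pullback_triple (X : Sets) :
  @weak_pullback (X * X * X)%type (X * X)%type (X * X)%type X
    (fun x => (x.1.1, x.1.2)) (fun x => (x.1.2, x.2)) snd fst.
Proof.
split=> // Z h k hk; exists (fun z => (h z, (k z).2)).
split; apply: funext => z /=; first by case: (h z).
have /= -> : (snd \o h) z = (fst \o k) z by rewrite hk.
by case: (k z).
Qed.

Section Ereal.
Variable R : realType.
Implicit Types (A B : set (\bar R)) (w y : \bar R).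

Lemma le_ereal_infDl A w y : (forall x, A x -> 0 <= x) -> 0 <= y ->
  (forall x, A x -> w <= x + y) -> w <= ereal_inf A + y.
Proof.
move=> A0; case: y => [y| |] // y0 wA.
  by rewrite -leeBlDr //; apply: le_ereal_inf_tmp => x /wA; rewrite -leeBlDr.
(* For [y = +oo] nothing can be subtracted; a nonnegative infimum rules out [-oo + +oo], so the sum
   is [+oo]. *)
have : 0 <= ereal_inf A by exact: le_ereal_inf_tmp.
by case: (ereal_inf A) => // *; rewrite addey ?leey.
Qed.

Lemma le_ereal_infD A B w :
  (forall x, A x -> 0 <= x) -> (forall y, B y -> 0 <= y) ->
  (forall x y, A x -> B y -> w <= x + y) -> w <= ereal_inf A + ereal_inf B.
Proof.
move=> A0 B0 wAB; apply: le_ereal_infDl => //; first exact: le_ereal_inf_tmp.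
move=> x Ax; rewrite addeC; apply: le_ereal_infDl => //; first exact: A0.
by move=> y By; rewrite addeC; apply: wAB.
Qed.

(** The subtraction-free form also holds at infinite values and turns (W2) into additive bounds. *)
Lemma euclid_leP (top : \bar R) (a b : dval top) (c : \bar R) : 0 <= c ->
  (val (euclid (a, b)) <= c) =
  (val a <= val b + c) && (val b <= val a + c).
Proof.
move=> c0; rewrite /= /euclid_val /=; case: eqP => [->|/eqP].
  by rewrite c0 leeDl.
case: a => a /= /andP[a0 _]; case: b => b /= /andP[b0 _].
case: a a0 => [a| |] //; case: b b0 => [b| |] //;
  case: c c0 => [c| |] // *; rewrite ?leey //.
by rewrite !lee_fin ler_norml lerNl opprB !lerBlDr andbC ![(c + _)%R]addrC.
Qed.

End Ereal.

Section Wasserstein.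
Variables (R : realType) (top : \bar R) (top_gt0 : 0 < top) (F : functor).
Variables (ev : F (dval top) -> dval top) (ev_wb : well_behaved ev).

Lemma dval_ge0 (a : dval top) : 0 <= val a.
Proof. by case/andP: (valP a). Qed.

Lemma evlift_fmap (X Y : Sets) (g : Y -> dval top) (f : X -> Y) t :
  evlift ev g (fmap F f t) = evlift ev (g \o f) t.
Proof. by rewrite /evlift /= fmap_compE. Qed.

(** (W3) read at [fmap F g t], as the equation that [weak_pullback_point] takes as input. *)
Lemma evlift_eq0P (X : Sets) (g : X -> dval top) t :
  val (evlift ev g t) = 0 <->
  exists z, fmap F g t = fmap F (val : set_type (@dzero R top) -> dval top) z.
Proof.
split=> [g0|[z gz]].
  have : (ev @^-1` @dzero R top) (fmap F g t) by [].
  by rewrite (wb_zero ev_wb) => -[z _ <-]; exists z.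
have : range (fmap F (val : set_type (@dzero R top) -> dval top)) (fmap F g t).
  by exists z.
by rewrite -(wb_zero ev_wb).
Qed.

Lemma evlift_zero (X : Sets) (g : X -> dval top) t :
  (forall x, val (g x) = 0) -> val (evlift ev g t) = 0.
Proof.
move=> g0; apply/evlift_eq0P.
pose k x : set_type (@dzero R top) := exist _ (g x) (mem_set (g0 x)).
by exists (fmap F k t); rewrite fmap_compE.
Qed.

(** (W2) at the image of [t] under the pairing of [f] and [g] bounds the distance of their lifts by
    the lift of [euclid \o fg]; (W1) passes from there to [h]. *)
Lemma evlift_triangle (X : Sets) (f g h : X -> dval top) t :
  (forall x, val (euclid (f x, g x)) <= val (h x)) ->
  val (evlift ev f t) <= val (evlift ev g t) + val (evlift ev h t).
Proof.
move=> fgh; pose fg x := (f x, g x).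
have := wb_euclid ev_wb (fmap F fg t).
rewrite !fmap_compE evlift_fmap => /le_trans/(_ (wb_monotone ev_wb fgh t)).
by rewrite euclid_leP ?dval_ge0 // => /andP[].
Qed.

Variables (X : Sets) (d : X * X -> dval top).

Local Notation W := (wasserstein ev top_gt0 d).

Lemma wasserstein_le (t1 t2 : F X) c :
  coupling t1 t2 c -> val (W (t1, t2)) <= val (evlift ev d c).
Proof. by move=> cpl; apply: (dinf_lbound top_gt0); exists c. Qed.

Lemma wasserstein_refl (t : F X) :
  (forall x, val (d (x, x)) = 0) -> val (W (t, t)) = 0.
Proof.
move=> d0; apply/eqP; rewrite eq_le dval_ge0 andbT.
pose diag (x : X) := (x, x).
have diag0 : val (evlift ev d (fmap F diag t)) = 0.
  by rewrite evlift_fmap evlift_zero.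
apply: le_trans (_ : val (evlift ev d (fmap F diag t)) <= 0); last first.
  by rewrite diag0.
apply: wasserstein_le.
by split; rewrite fmap_compE [_ \o _](_ : _ = id) // Defs.fmap_id.
Qed.

Lemma wasserstein_sym (t1 t2 : F X) :
  (forall x y, d (x, y) = d (y, x)) -> W (t1, t2) = W (t2, t1).
Proof.
move=> dC; suff le12 u1 u2 : val (W (u1, u2)) <= val (W (u2, u1)).
  by apply: val_inj; apply/eqP; rewrite eq_le !le12.
apply: dinf_greatest => _ [c [/= c1 c2] <-].
have <- : evlift ev d (fmap F (fun x => (x.2, x.1)) c) = evlift ev d c.
  by rewrite evlift_fmap; congr evlift; apply: funext => -[x y]; exact: dC.
apply: wasserstein_le.
by split; rewrite fmap_compE.
Qed.

Hypothesis F_wpb : preserves_weak_pullbacks F.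

Lemma glue_couplings (t1 t2 t3 : F X) c12 c23 :
  coupling t1 t2 c12 -> coupling t2 t3 c23 ->
  exists c : F (X * X * X)%type,
    fmap F (fun x => (x.1.1, x.1.2)) c = c12 /\
    fmap F (fun x => (x.1.2, x.2)) c = c23.
Proof.
move=> [_ c2] [c2' _].
by apply: weak_pullback_point (F_wpb (weak_pullback_triple X)) _; rewrite c2.
Qed.

Lemma wasserstein_triangle (t1 t2 t3 : F X) : is_pseudometric d ->
  val (W (t1, t3)) <= val (W (t1, t2)) + val (W (t2, t3)).
Proof.
case=> _ dC dD.
have ge0 (A : set (dval top)) x : (top |` [set val a | a in A]) x -> 0 <= x.
  by case=> [->|[a _ <-]]; [exact: ltW|exact: dval_ge0].
apply: le_ereal_infD => [||x y Ax By]; try exact: ge0.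
have Wtop : val (W (t1, t3)) <= top by case/andP: (valP (W (t1, t3))).
(* If [x] or [y] is the adjoined [top], the sum already exceeds every distance; otherwise both come
   from couplings. *)
case: Ax (ge0 _ _ Ax) (ge0 _ _ By) => [-> _ y0|].
  by rewrite (le_trans Wtop) ?leeDl.
case: By => [-> _ x0 _|]; first by rewrite (le_trans Wtop) ?leeDr.
move=> [_ [c23 cpl23 <-] <-] [_ [c12 cpl12 <-] <-] _ _.
have [c [c_12 c_23]] := glue_couplings cpl12 cpl23.
apply: (@le_trans _ _ (val (evlift ev d (fmap F (fun x => (x.1.1, x.2)) c)))).
  apply: wasserstein_le.
  case: cpl12 cpl23 => /= <- _ [_ <-].
  by split; rewrite -?c_12 -?c_23 !fmap_compE.
rewrite -c_12 -c_23 !evlift_fmap addeC; apply: evlift_triangle.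
move=> -[[x1 x2] x3] /=; rewrite -[euclid_val _]/(val (euclid (_, _))).
(* The two bounds are triangle inequalities, first through [x2], then through [x1]; the latter uses
   symmetry. *)
rewrite euclid_leP ?dval_ge0 // addeC dD /=.
by rewrite addeC (dC x1 x2) dD.
Qed.

Lemma weak_pullback_diagonal : is_metric d ->
  exists k : X -> set_type (@dzero R top),
    weak_pullback (fun x => (x, x)) k d val.
Proof.
move=> [[d0 _ _] d_eq].
exists (fun x => exist _ (d (x, x)) (mem_set (d0 x))); split=> // Z h k hk.
(* [d] vanishes at [h z], so separation puts [h z] on the diagonal and [fst \o h] mediates. *)
have hE z : (h z).1 = (h z).2.
  apply: d_eq; rewrite -surjective_pairing -[d _]/((d \o h) z) hk.
  exact: set_mem (valP (k z)).
have diagE : (fun x => (x, x)) \o (fst \o h) = h.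
  by apply: funext => z /=; rewrite {2}hE -surjective_pairing.
exists (fst \o h); split=> //; apply: funext => z; apply: val_inj => /=.
by rewrite -[(_, _)]/(((fun x => (x, x)) \o (fst \o h)) z) diagE
  -[LHS]/((d \o h) z) hk.
Qed.

(** Since [c] is the image of some [t] under the diagonal, both of its marginals equal [t]. *)
Lemma coupling_eq0 (t1 t2 : F X) c : is_metric d ->
  coupling t1 t2 c -> val (evlift ev d c) = 0 -> t1 = t2.
Proof.
move=> /weak_pullback_diagonal[k kP] [<- <-] /evlift_eq0P[z cz].
have [t [<- _]] := weak_pullback_point (F_wpb kP) cz.
by rewrite !fmap_compE.
Qed.

End Wasserstein.

Theorem theorem5p24 (R : realType) (top : \bar R) (top_gt0 : (0 < top)%E)
  (F : functor) (F_wpb : preserves_weak_pullbacks F)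
  (ev : F (dval top) -> dval top) (ev_wb : well_behaved ev)
  (X : Sets) (d : X * X -> dval top) (d_metric : is_metric d)
  (optimal_zero : forall t1 t2 : F X,
     val (wasserstein ev top_gt0 d (t1, t2)) = 0%E ->
     exists2 c, coupling t1 t2 c & val (evlift ev d c) = 0%E) :
  is_metric (wasserstein ev top_gt0 d).
Proof.
have [d_pseudo _] := d_metric; have [d0 dC _] := d_pseudo.
split; first split=> *.
- exact: wasserstein_refl.
- exact: wasserstein_sym.
- exact: wasserstein_triangle.
(* An infimum equal to [0] need not be attained; [optimal_zero] supplies the coupling of cost
   [0]. *)
by move=> t1 t2 /optimal_zero[c]; exact: coupling_eq0.
Qed.
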